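(* Let $M$ and $N$ be two locally compact Hausdorff spaces that are countable at infinity. Then for any continuous function $f\colon M\times N\to\mathbb{R}$ there are continuous functions $F\colon M\to\mathbb{R}$ and $G\colon N\to\mathbb{R}$ such that $$f(t,x)\leq F(t)+G(x)\qquad\text{for all }(t,x)\in M\times N.$$
   Context: A locally compact Hausdorff space is called countable at infinity if it is $\sigma$-compact, i.e. a countable union of compact subsets; equivalently, it admits an exhaustion $M=\bigcup_{i\in\mathbb{N}_0}K_i$ by compact subsets with $K_0=\emptyset$ and $K_i\subset\mathring{K}_{i+1}$ for all $i$, where $\mathring{K}$ denotes the interior of $K$. The product $M\times N$ carries the product topology. *)

(* Defs.v *)
From mathcomp Require Import all_boot all_order all_algebra.
From mathcomp Require Import all_classical all_reals all_analysis.

Local Open Scope classical_set_scope.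

Definition sigma_compact (T : topologicalType) : Prop :=
  exists K : nat -> set T,
    (forall i : nat, compact (K i)) /\ \bigcup_(i in [set: nat]) K i = [set: T].

(* Main.v *)
Require Import Defs.
From mathcomp Require Import all_boot all_order all_algebra.
From mathcomp Require Import all_classical all_reals all_analysis.
Import Order.TTheory GRing.Theory Num.Theory.
Import numFieldNormedType.Exports.

Local Open Scope classical_set_scope.
Local Open Scope ring_scope.

(** Exhaust M and N by compact sets K n and L n that start with the empty set,
    each contained in the interior of the next ([sigma_compact_exhaustion]).
    Let c n >= 0 bound f on the compact set K n.+1 * L n.+1.  By
    [exhaustion_domination] there are nonnegative continuous functions F on M
    and G on N such that F >= c n off K n and G >= c n off L n, for all n.  For
    a point (t, x) take the n such that (t, x) lies in K n.+1 * L n.+1 but not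
    in K n * L n.  Then f (t, x) <= c n; moreover t is outside K n or x is
    outside L n, so F t or G x is at least c n, and the other is nonnegative.

    The function F is the sum of c i * h i, where h i is a Urysohn function
    that is 0 on K i.-1 and 1 off K i; near each point only finitely many terms
    do not vanish.  Both the Urysohn functions and the exhaustion are
    obtained from the one-point compactification, which is normal because it is
    compact and Hausdorff. *)

Lemma one_point_compactification_normal {X : topologicalType} :
  locally_compact [set: X] -> hausdorff_space X ->
  normal_space (one_point_compactification X).
Proof.
move=> lcX hX; apply: compact_normal.
  exact: one_point_compactification_hausdorff.
exact: one_point_compactification_compact.
Qed.

Lemma one_point_compactification_closed_some {X : topologicalType}
    (K : set X) :
  locally_compact [set: X] -> hausdorff_space X -> compact K ->
  closed (Some @` K : set (one_point_compactification X)).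
Proof.
move=> lcX hX cK; apply: compact_closed.
  exact: one_point_compactification_hausdorff.
apply: continuous_compact cK; apply: continuous_subspaceT.
exact: one_point_compactification_some_continuous.
Qed.

(** In the one-point compactification, normality provides a neighborhood of K
    whose closure avoids the point at infinity.  The complement of this closure
    is a neighborhood of infinity, hence it contains the complement of a
    compact set W, and W contains the neighborhood of K. *)
Lemma compact_sub_interior_compact {X : topologicalType} (K : set X) :
  locally_compact [set: X] -> hausdorff_space X -> compact K ->
  exists2 W : set X, compact W & K `<=` W°.
Proof.
move=> lcX hX cK; pose opc := one_point_compactification X.
have nbhsA : set_nbhs (Some @` K : set opc) (Some @` [set: X]).
  move=> _ [x _ <-]; apply: one_point_compactification_some_nbhs.
  exact: filterT.
have clA := one_point_compactification_closed_some K lcX hX cK.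
have [U KU clU] : filter_from (set_nbhs (Some @` K : set opc)) closure
    (Some @` [set: X]) by exact: one_point_compactification_normal.
have [W [cW _] WU] : nbhs (None : opc) (~` closure U).
  apply: open_nbhs_nbhs; split; first exact/closed_openC/closed_closure.
  by move=> /clU[].
exists W => // x Kx; have Ux : nbhs x (Some @^-1` U) by exact: KU (imageP _ Kx).
apply: filterS Ux => y Uy; apply: contrapT => nWy.
apply: (WU (Some y)); first by left; exists y.
exact: subset_closure.
Qed.

(** X itself need not be normal, but in the
    one-point compactification K stays closed and U stays open, so Urysohn's
    lemma applies there, and the function is then restricted to X. *)
Lemma compact_urysohn (R : realType) {X : topologicalType} (K U : set X) :
  locally_compact [set: X] -> hausdorff_space X ->
  compact K -> open U -> K `<=` U ->
  exists h : X -> R, [/\ continuous h, forall x, 0 <= h x,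
    forall x, K x -> h x = 0 & forall x, ~ U x -> h x = 1].
Proof.
move=> lcX hX cK oU KU; pose opc := one_point_compactification X.
have cB : closed (~` (Some @` U) : set opc).
  by apply: open_closedC; exact: one_point_compactification_open_some.
have AB0 : Some @` K `&` ~` (Some @` U) = set0 :> set opc.
  by apply/disjoints_subset; rewrite setCK; exact: image_subset.
have /normal_separatorP sep := one_point_compactification_normal lcX hX.
have cA := one_point_compactification_closed_some K lcX hX cK.
have /(uniform_separatorP (R := R))[h [ch h01 hA hB]] := sep R _ _ cA cB AB0.
exists (h \o Some); split.
- move=> x; apply: continuous_comp; last exact: ch.
  exact: one_point_compactification_some_continuous.
- move=> x /=; have /h01 : range h (h (Some x)) by exists (Some x).
  by rewrite /= in_itv /= => /andP[].
- by move=> x Kx; apply: hA; exists (Some x) => //; exists x.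
- move=> x nUx; apply: hB; exists (Some x) => // -[y Uy [yx]].
  by apply: nUx; rewrite -yx.
Qed.

Definition compact_exhaustion {X : topologicalType} (K : nat -> set X) : Prop :=
  [/\ K 0%N = set0, forall n, compact (K n),
      forall n, K n `<=` (K n.+1)° & forall x, exists n, K n x].

Lemma compact_exhaustion_mono {X : topologicalType} (K : nat -> set X) :
  compact_exhaustion K -> forall m n, (m <= n)%N -> K m `<=` K n.
Proof.
move=> [_ _ KS _] m n; elim: n => [|n IH]; first by rewrite leqn0 => /eqP ->.
rewrite leq_eqVlt ltnS => /predU1P[-> //|/IH Kmn].
apply: subset_trans Kmn _; apply: subset_trans (KS n) _.
exact: interior_subset.
Qed.

(** If C n are compact sets covering X, each step takes K n.+1 to be a compact
    set whose interior contains both K n and C n. *)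
Lemma sigma_compact_exhaustion {X : topologicalType} :
  locally_compact [set: X] -> hausdorff_space X -> sigma_compact X ->
  exists K : nat -> set X, compact_exhaustion K.
Proof.
move=> lcX hX [C [cC Ccov]].
have /choice[W WP] : forall A : set X, exists W : set X,
    compact A -> compact W /\ A `<=` W°.
  move=> A; have [cA|ncA] := pselect (compact A); last by exists set0.
  by have [W cW AW] := compact_sub_interior_compact A lcX hX cA; exists W.
pose K := fix K n := if n is m.+1 then W (K m `|` C m) else set0.
have cK n : compact (K n).
  elim: n => [|n IH]; first exact: compact0.
  exact: (WP _ (compactU IH (cC n))).1.
have KS n : K n `|` C n `<=` (K n.+1)°.
  exact: (WP _ (compactU (cK n) (cC n))).2.
exists K; split=> // [n|x].
  exact: subset_trans (@subsetUl _ _ _) (KS n).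
have [n _ Cnx] : (\bigcup_(i in [set: nat]) C i) x by rewrite Ccov.
by exists n.+1; apply: interior_subset; apply: KS; right.
Qed.

(** F is a locally finite sum of multiples of Urysohn functions; all of them
    with index less than m + 2 suffice on K m.+1, which is a neighborhood of
    each point of K m, so F is locally a finite sum of continuous functions. *)
Lemma exhaustion_domination (R : realType) {X : topologicalType}
    (K : nat -> set X) (c : nat -> R) :
  locally_compact [set: X] -> hausdorff_space X -> compact_exhaustion K ->
  (forall n, 0 <= c n) ->
  exists F : X -> R, [/\ continuous F, forall x, 0 <= F x &
    forall n x, ~ K n x -> c n <= F x].
Proof.
move=> lcX hX exK c0; have Kmono := compact_exhaustion_mono K exK.
case: exK => K0 cK KS Kcov.
have /choice[h hP] : forall n, exists h : X -> R, [/\ continuous h,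
    forall x, 0 <= h x, forall x, K n.-1 x -> h x = 0 &
    forall x, ~ K n x -> h x = 1].
  case=> [|n] /=.
    exists (cst 1); split=> //; first by move=> x; exact: cvg_cst.
    by move=> x; rewrite K0.
  have [h [ch h0 hK hU]] :=
    compact_urysohn R _ _ lcX hX (cK n) (open_interior (K n.+1)) (KS n).
  exists h; split=> // x nKx; apply: hU; apply: contra_not nKx.
  exact: interior_subset.
(* As h i vanishes on K m for i > m, the partial sum up to index N x is already
   the whole sum at x, for any choice of N x with x in K (N x). *)
have [N KN] := choice Kcov.
pose S m x := \sum_(i < m) c i * h i x.
have stable m x n : K m x -> (m < n)%N -> S n x = S m.+1 x.
  move=> Kmx mn; rewrite /S [RHS](big_ord_widen n (fun i => c i * h i x)) //.
  rewrite [RHS]big_mkcond /=; apply: eq_bigr => i _; case: ltnP => // mi.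
  have [_ _ hi _] := hP i; rewrite hi ?mulr0 //.
  by apply: Kmono Kmx; rewrite -ltnS (leq_trans mi) // leqSpred.
pose F x := S (N x).+1 x.
have FE m x : K m x -> F x = S m.+1 x.
  move=> Kmx; rewrite /F; case: (leqP m (N x)) => [mN|Nm].
    by rewrite (stable m).
  by rewrite -(stable (N x) x m.+1) // ltnS ltnW.
have chi0 i x : 0 <= c i * h i x by rewrite mulr_ge0 //; have [] := hP i.
exists F; split.
- move=> x; have Kx := KS _ _ (KN x).
  have cS : continuous (S (N x).+2).
    apply: continuous_big => [|i _]; first exact: add_continuous.
    move=> y; apply: cvgM; first exact: cvg_cst.
    by have [+ _ _ _] := hP i; exact.
  rewrite /continuous_at (FE (N x).+1); last exact: interior_subset.
  apply: cvg_trans (cS x); apply: near_eq_cvg.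
  by apply: filterS Kx => y /FE ->.
- by move=> x; apply: sumr_ge0 => i _.
- move=> n x nKx; have ltnN : (n < N x)%N.
    by rewrite ltnNge; apply/negP => /Kmono; move/(_ x (KN x)).
  have ltn : (n < (N x).+1)%N by rewrite ltnW.
  rewrite /F /S (bigD1 (Ordinal ltn)) //=.
  have [_ _ _ ->//] := hP n.
  by rewrite mulr1 lerDl sumr_ge0.
Qed.

Lemma continuous_compact_ubound (R : realType) {X : topologicalType}
    (f : X -> R) (A : set X) :
  continuous f -> compact A -> exists2 c, 0 <= c & forall x, A x -> f x <= c.
Proof.
move=> cf cA; have /compact_bounded[M [_ fM]] : compact (f @` A).
  by apply: continuous_compact cA; exact: continuous_subspaceT.
exists (`|M| + 1) => [|x Ax]; first by rewrite addr_ge0.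
apply: le_trans (ler_norm _) _; apply: (fM (`|M| + 1)); last by exists x.
by rewrite (le_lt_trans (ler_norm M)) // ltrDl.
Qed.

Theorem mainTheorem1 (R : realType) (M N : topologicalType)
    (lcM : locally_compact [set: M]) (hausM : hausdorff_space M)
    (scM : sigma_compact M)
    (lcN : locally_compact [set: N]) (hausN : hausdorff_space N)
    (scN : sigma_compact N)
    (f : M * N -> R) (cf : continuous f) :
  exists (F : M -> R) (G : N -> R),
    continuous F /\ continuous G /\
    forall (t : M) (x : N), f (t, x) <= F t + G x.
Proof.
have [K exK] := sigma_compact_exhaustion lcM hausM scM.
have [L exL] := sigma_compact_exhaustion lcN hausN scN.
have [K0 cK _ Kcov] := exK; have [L0 cL _ Lcov] := exL.
have /choice[c cP] : forall n, exists c : R, 0 <= c /\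
    forall t x, K n.+1 t -> L n.+1 x -> f (t, x) <= c.
  move=> n; have [c c0 fc] := continuous_compact_ubound R f _ cf
    (compact_setX (cK n.+1) (cL n.+1)).
  by exists c; split=> // t x Kt Lx; apply: fc.
have c0 n : 0 <= c n by have [] := cP n.
have [F [cF F0 FK]] := exhaustion_domination R K c lcM hausM exK c0.
have [G [cG G0 GL]] := exhaustion_domination R L c lcN hausN exL c0.
exists F, G; split=> //; split=> // t x.
(* The least n with (t, x) in K n * L n is positive because K 0 is empty. *)
have exn : exists n, `[< K n t /\ L n x >].
  have [m Km] := Kcov t; have [n Ln] := Lcov x.
  exists (maxn m n); apply/asboolP; split.
    exact: compact_exhaustion_mono exK _ _ (leq_maxl m n) _ Km.
  exact: compact_exhaustion_mono exL _ _ (leq_maxr m n) _ Ln.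
case: (ex_minnP exn) => -[|n] /asboolP[Kt Lx] minn; first by rewrite K0 in Kt.
have [_ /(_ t x Kt Lx) ftx] := cP n; apply: le_trans ftx _.
have [Knt|nKnt] := pselect (K n t); last by rewrite -[c n]addr0 lerD ?FK.
have [Lnx|nLnx] := pselect (L n x); last by rewrite -[c n]add0r lerD ?GL.
have /minn : `[< K n t /\ L n x >] by apply/asboolP.
by rewrite ltnn.
Qed.
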